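(* The analogue of the classical Lebesgue dominated convergence theorem does not hold for ${}^{\bullet}\mathbb{R}$ with any topology on Fermat reals: there is no topology $\tau$ on Fermat reals such that, for every sequence $(f_n:{}^{\bullet}\mathbb{R}\to{}^{\bullet}\mathbb{R})_{n\ge1}$ of quasi-standard smooth functions that is pointwise convergent in $\tau$ and satisfies $|f_n|\le g$ for all $n$ for some quasi-standard smooth function $g:{}^{\bullet}\mathbb{R}\to{}^{\bullet}\mathbb{R}$, the limit $\lim_{n\to\infty}\int_0^1 f_n(x)\,dx$ exists in ${}^{\bullet}\mathbb{R}$ with respect to $\tau$.
   Context: Fermat reals: for $U\subseteq\mathbb{R}^n$ open, a little-oh polynomial on $U$ is a function $x:[0,\epsilon)\to U$ ($\epsilon>0$ depending on $x$) such that $x(t)=r+\sum_{i=1}^k\alpha_i t^{a_i}+o(t)$ as $t\to0^+$ for some $k\in\mathbb{N}$, $\alpha_i\in\mathbb{R}^n$, $a_i>0$, with $r=x(0)\in U$. Two such $x,y$ are equivalent if $x(0)=y(0)$ and $x(t)-y(t)=o(t)$; the quotient set is ${}^{\bullet}U$. Every $x\in{}^{\bullet}U$ is uniquely of the form $x={}^{\circ}x+\sum_{i=1}^l\beta_i t^{b_i}$ with ${}^{\circ}x\in U$ (standard part), $\beta_i\in\mathbb{R}^n\setminus\{0\}$, $0<b_1<\cdots<b_l\le1$; allowing $\beta_i=0$ gives a quasi-decomposition. With pointwise operations ${}^{\bullet}\mathbb{R}$ is a commutative unital ring; ${}^{\bullet}(\mathbb{R}^n)$ is identified with $({}^{\bullet}\mathbb{R})^n$,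 written ${}^{\bullet}\mathbb{R}^n$, and ${}^{\bullet}U=\{x\in{}^{\bullet}\mathbb{R}^n:{}^{\circ}x\in U\}$. $\mathbb{R}$ sits in ${}^{\bullet}\mathbb{R}$ as constants. ${}^{\bullet}\mathbb{R}$ is totally ordered: write $x={}^{\circ}x+\sum_{i=1}^n\alpha_it^{a_i}$, $y={}^{\circ}y+\sum_{i=1}^n\beta_it^{a_i}$ with common exponents $0<a_1<\dots<a_n\le 1$; then $x\le y$ iff $({}^{\circ}x,\alpha_1,\ldots,\alpha_n)\le({}^{\circ}y,\beta_1,\ldots,\beta_n)$ lexicographically. $|y|=\max(y,-y)$. For a smooth map $f:U\to V$ of open subsets of Euclidean spaces, ${}^{\bullet}f:{}^{\bullet}U\to{}^{\bullet}V$ is $[x]\mapsto[f\circ x]$. For $A\subseteq{}^{\bullet}\mathbb{R}^n$, $f:A\to{}^{\bullet}\mathbb{R}$ is quasi-standard smooth if for every $a\in A$ there exist an open neighbourhood $U$ of ${}^{\circ}a$ in $\mathbb{R}^n$, an open subset $V$ of some Euclidean space, a smooth map $\alpha:V\times U\to\mathbb{R}$ and a fixed $v\in{}^{\bullet}V$ with $f(x)={}^{\bullet}\alpha(v,x)$ for all $x\in A\cap{}^{\bullet}U$. Integral: for a quasi-standard smooth $f:{}^{\bullet}\mathbb{R}\to{}^{\bullet}\mathbb{R}$ there are an open neighbourhood $U$ of the real interval $[0,1]_{\mathbb{R}}$, smooth $\alpha_0,\ldots,\alpha_m:U\to\mathbb{R}$ and $0<a_1<\cdots<a_m\le1$ with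 $f(x)={}^{\bullet}\alpha_0(x)+\sum_{i=1}^m{}^{\bullet}\alpha_i(x)t^{a_i}$ for $x\in{}^{\bullet}U$, and $\int_0^1f(x)\,dx:=\int_0^1\alpha_0(x)\,dx+\sum_{i=1}^m\bigl(\int_0^1\alpha_i(x)\,dx\bigr)t^{a_i}$, which does not depend on the choices. A topology on Fermat reals means a Hausdorff topology on ${}^{\bullet}\mathbb{R}$ making $({}^{\bullet}\mathbb{R},+)$ a topological group. A sequence $(f_n)$ of functions into ${}^{\bullet}\mathbb{R}$ is pointwise convergent in $\tau$ if $(f_n(x))_n$ has a limit in $\tau$ for each $x$ in the domain (the limit function need not be quasi-standard smooth). *)

(* Defs.v *)
From HB Require Import structures.
From mathcomp Require Import all_boot all_order all_algebra.
From mathcomp Require Import ring.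
From mathcomp Require Import all_classical all_reals all_analysis.
Set Implicit Arguments.
Unset Strict Implicit.
Unset Printing Implicit Defensive.
Import Order.TTheory GRing.Theory Num.Theory.
Import numFieldNormedType.Exports.
Local Open Scope classical_set_scope.
Local Open Scope ring_scope.

Section LittleOhPolynomials.
Variable R : realType.
Implicit Types (x y u : R -> R) (s : seq (R * R)).

Definition power_sum s (t : R) : R := \sum_(p <- s) p.1 * t `^ p.2.

(* Paths defined on some [0, e) are represented by total functions on R: only
   x 0 and the germ of x at 0^+ are ever used. *)
Definition is_little_oh_poly x : Prop :=
  exists2 s : seq (R * R), all (fun p : R * R => 0 < p.2) s
    & (fun t => x t - (x 0 + power_sum s t)) =o_ (0^'+) (@id R).

Lemma power_sum_cvg0 s : all (fun p : R * R => 0 < p.2) s ->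
  power_sum s t @[t --> 0^'+] --> (0 : R).
Proof.
rewrite /power_sum; elim: s => [_|p s ih /= /andP[p0 /ih {}ih]].
  by under eq_fun do rewrite big_nil; exact: cvg_cst.
under eq_fun do rewrite big_cons.
have := cvgD (cvgM (cvg_cst p.1) (powR_cvg0 p0)) ih.
by rewrite mulr0 addr0; apply.
Qed.

Lemma littleo_id_mulr u y (l : R) : u =o_ (0^'+) (@id R) ->
  y t @[t --> 0^'+] --> l -> (fun t => u t * y t) =o_ (0^'+) (@id R).
Proof.
move=> /eqoP uo yl; apply/eqoP => e e0.
have l0 : 0 < `|l| + 1 by rewrite ltr_wpDl.
move/cvgr_dist_lt : yl => /(_ _ ltr01) yl.
near=> t.
have h1 : `|u t| <= e / (`|l| + 1) * `|t|.
  by near: t; apply: uo; rewrite divr_gt0.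
have h2 : `|y t| <= `|l| + 1.
  have : `|l - y t| < 1 by near: t.
  move=> h; rewrite -[y t](subKr l) (le_trans (ler_normB _ _))//.
  by rewrite lerD2l ltW.
rewrite normrM (le_trans (ler_pM _ _ h1 h2))//.
by rewrite mulrAC divfK// gt_eqF.
Unshelve. all: by end_near. Qed.

Lemma littleo_id_cvg0 u : u =o_ (0^'+) (@id R) -> u t @[t --> 0^'+] --> (0 : R).
Proof.
move=> /eqoP uo; apply/cvgr0Pnorm_le => e e0; near=> t.
have : `|u t| <= 1 * `|t| by near: t; apply: uo.
rewrite mul1r => /le_trans; apply; rewrite gtr0_norm//.
by near: t; apply: nbhs_right_le.
Unshelve. all: by end_near. Qed.

Lemma is_little_oh_poly_cvg x :
  is_little_oh_poly x -> x t @[t --> 0^'+] --> x 0.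
Proof.
move=> [s s0 /littleo_id_cvg0 xs].
have := cvgD xs (cvgD (cvg_cst (x 0)) (power_sum_cvg0 s0)).
rewrite !addr0 add0r => /(_ _ _ _); apply: cvg_trans; apply: near_eq_cvg.
by near=> t; rewrite /= subrK.
Unshelve. all: by end_near. Qed.

Lemma is_little_oh_poly_cst (c : R) : is_little_oh_poly (cst c).
Proof.
exists [::] => //; apply/eqoP => e e0; near=> t.
by rewrite /power_sum big_nil/= addr0 subrr normr0 mulr_ge0// ltW.
Unshelve. all: by end_near. Qed.

Lemma is_little_oh_polyB x y : is_little_oh_poly x -> is_little_oh_poly y ->
  is_little_oh_poly (fun t => x t - y t).
Proof.
move=> [s s0 xs] [r r0 yr]; exists (s ++ [seq (- p.1, p.2) | p <- r]).
  by rewrite all_cat s0 all_map.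
have -> : (fun t => x t - y t - (x 0 - y 0 +
      power_sum (s ++ [seq (- p.1, p.2) | p <- r]) t)) =
    (fun t => x t - (x 0 + power_sum s t)) -
    (fun t => y t - (y 0 + power_sum r t)).
  apply/funext => t; rewrite /power_sum big_cat big_map/=.
  under [X in _ + (_ + X)]eq_bigr do rewrite mulNr.
  rewrite sumrN.
  transitivity ((x t - (x 0 + power_sum s t)) - (y t - (y 0 + power_sum r t))) => //.
  by rewrite /power_sum; ring.
by apply: add2o => //; exact: oppfo.
Qed.

Lemma is_little_oh_polyM x y : is_little_oh_poly x -> is_little_oh_poly y ->
  is_little_oh_poly (fun t => x t * y t).
Proof.
move=> px py; have xl := is_little_oh_poly_cvg px.
have yl := is_little_oh_poly_cvg py.
move: px py => [s s0 xs] [r r0 yr].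
exists ([seq (y 0 * p.1, p.2) | p <- s] ++ [seq (x 0 * q.1, q.2) | q <- r] ++
        [seq (p.1 * q.1, p.2 + q.2) | p <- s, q <- r]).
  rewrite !all_cat !all_map; apply/and3P; split; [exact: s0|exact: r0|].
  apply/allP => _ /allpairsP[[p q] /= [ps qr ->]] /=.
  by rewrite addr_gt0//; [move/allP : s0; exact|move/allP : r0; exact].
set u := fun t => x t - (x 0 + power_sum s t) in xs.
set v := fun t => y t - (y 0 + power_sum r t) in yr.
have -> : (fun t => x t * y t - (x 0 * y 0 + power_sum
    ([seq (y 0 * p.1, p.2) | p <- s] ++ [seq (x 0 * q.1, q.2) | q <- r] ++
     [seq (p.1 * q.1, p.2 + q.2) | p <- s, q <- r]) t)) =
    (fun t => u t * y t) + (fun t => v t * (x 0 + power_sum s t)).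
  apply/funext => t.
  have -> : power_sum ([seq (y 0 * p.1, p.2) | p <- s] ++
      [seq (x 0 * q.1, q.2) | q <- r] ++
      [seq (p.1 * q.1, p.2 + q.2) | p <- s, q <- r]) t =
      y 0 * power_sum s t + x 0 * power_sum r t + power_sum s t * power_sum r t.
    rewrite /power_sum !big_cat !big_map/= big_allpairs_dep/= addrA; congr (_ + _ + _).
    - by rewrite mulr_sumr; apply: eq_bigr => p _; rewrite mulrA.
    - by rewrite mulr_sumr; apply: eq_bigr => p _; rewrite mulrA.
    - rewrite mulr_suml big_seq [RHS]big_seq; apply: eq_bigr => p ps.
      rewrite mulr_sumr big_seq [RHS]big_seq; apply: eq_bigr => q qr.
      rewrite powRD; last first.
        by rewrite gt_eqF// addr_gt0//; [move/allP : s0|move/allP : r0]; exact.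
      by rewrite mulrACA.
  transitivity (u t * y t + v t * (x 0 + power_sum s t)) => //.
  by rewrite /u /v; ring.
apply: add2o; first exact: littleo_id_mulr xs yl.
apply: littleo_id_mulr yr _.
exact: (cvgD (cvg_cst (x 0)) (power_sum_cvg0 s0)).
Qed.

Lemma is_little_oh_poly_powR (a : R) :
  0 < a -> is_little_oh_poly (fun t => t `^ a).
Proof.
move=> a0; exists [:: (1, a)]; rewrite /= ?a0//.
apply/eqoP => e e0; near=> t.
rewrite powR0 ?gt_eqF// /power_sum big_seq1 mul1r add0r subrr normr0.
by rewrite mulr_ge0// ltW.
Unshelve. all: by end_near. Qed.

Definition little_oh_poly : pred (R -> R) := fun x => `[< is_little_oh_poly x >].

Fact little_oh_poly_subring : subring_closed little_oh_poly.
Proof.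
split; first by apply/asboolP; exact: is_little_oh_poly_cst.
- by move=> x y /asboolP px /asboolP py; apply/asboolP; exact: is_little_oh_polyB.
- by move=> x y /asboolP px /asboolP py; apply/asboolP; exact: is_little_oh_polyM.
Qed.
HB.instance Definition _ :=
  GRing.isSubringClosed.Build (R -> R) little_oh_poly little_oh_poly_subring.

Record LittleOh : Type := MkLittleOh {
  loh_fun :> R -> R ;
  _ : loh_fun \in little_oh_poly }.

HB.instance Definition _ := [isSub for loh_fun].
HB.instance Definition _ := [Choice of LittleOh by <:].
HB.instance Definition _ := [SubChoice_isSubComNzRing of LittleOh by <:].

Definition negligible (x : LittleOh) : bool :=
  `[< x 0 = 0 /\ (x : R -> R) =o_ (0^'+) (@id R) >].

Fact negligible_ideal : idealr_closed negligible.
Proof.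
split.
- apply/asboolP; split => //; apply/eqoP => e e0; near=> t.
  by rewrite [X in `|X|](_ : _ = 0)// normr0 mulr_ge0// ltW.
- by apply/negP => /asboolP[/eqP]; rewrite [X in X == _](_ : _ = 1)// oner_eq0.
- move=> a u v /asboolP[u0 uo] /asboolP[v0 vo]; apply/asboolP; split.
    by change (a 0 * u 0 + v 0 = 0); rewrite u0 v0 mulr0 addr0.
  have -> : ((a * u + v : LittleOh) : R -> R) =
      (fun t => u t * a t) + (v : R -> R).
    by apply/funext => t; change (a t * u t + v t = u t * a t + v t); rewrite mulrC.
  apply: add2o => //; apply: littleo_id_mulr uo _.
  by apply: is_little_oh_poly_cvg; apply/asboolP; case: a.
Unshelve. all: by end_near. Qed.
HB.instance Definition _ := isIdealr.Build LittleOh negligible negligible_ideal.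

Definition fermat : Type := {ideal_quot (negligible : idealr LittleOh)}.
HB.instance Definition _ := GRing.ComNzRing.on fermat.
HB.instance Definition _ := EqQuotient.on fermat.

End LittleOhPolynomials.

Section FermatReals.
Variable R : realType.
Local Notation fermat := (fermat R).

(* The class of a little-oh polynomial x (and 0 on other functions). *)
Definition germ (x : R -> R) : fermat :=
  \pi_fermat%qT (insubd (0 : LittleOh R) x).

Definition path_of (x : fermat) : R -> R := repr x.

Definition fconst (r : R) : fermat := germ (cst r).

Definition st (x : fermat) : R := path_of x 0.

Definition tpow (a : R) : fermat := germ (fun t => t `^ a).

Definition quasi_decomp (r : R) n (a c : n.-tuple R) : fermat :=
  fconst r + \sum_(i < n) fconst (tnth c i) * tpow (tnth a i).

Definition exponents n (a : n.-tuple R) : bool :=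
  sorted <%R a && all (fun e => 0 < e <= 1) a.

Definition fermat_le (x y : fermat) : Prop :=
  exists n (a c d : n.-tuple R),
    [/\ exponents a, x = quasi_decomp (st x) a c, y = quasi_decomp (st y) a d
      & ((st x :: c : seqlexi R) <= (st y :: d : seqlexi R))%O].

Definition fermat_max (x y : fermat) : fermat :=
  if `[< fermat_le x y >] then y else x.

Definition fermat_abs (y : fermat) : fermat := fermat_max y (- y).

Fixpoint Ck (E : normedModType R) (k : nat) (W : set E) (f : E -> R) : Prop :=
  if k is k'.+1
  then (forall p : E, W p -> differentiable f p) /\
       (forall v : E, Ck k' W ('D_v f))
  else forall p : E, W p -> {for p, continuous f}.

(* Only used for open W; the values of f outside W are irrelevant. *)
Definition smooth_on (E : normedModType R) (W : set E) (f : E -> R) : Prop :=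
  forall k, Ck k W f.

(* The Fermat extension of a smooth f, where the points of the extension of
   R^n are vectors of n Fermat reals; on the extension of the (open) domain of f
   the composite below is a little-oh polynomial and its class does not depend
   on the chosen representatives. *)
Definition fext n (f : 'rV[R]_n -> R) (x : 'rV[fermat]_n) : fermat :=
  germ (fun t => f (\row_i path_of (x 0 i) t)).

Definition fext1 (f : R -> R) (x : fermat) : fermat := germ (f \o path_of x).

Definition ext_set n (U : set 'rV[R]_n) : set 'rV[fermat]_n :=
  [set x | U (map_mx st x)].

Definition prod_set p n (V : set 'rV[R]_p) (U : set 'rV[R]_n) :
    set 'rV[R]_(p + n) :=
  [set w | V (lsubmx w) /\ U (rsubmx w)].

Definition quasi_standard_smooth_on n (A : set 'rV[fermat]_n)
    (f : 'rV[fermat]_n -> fermat) : Prop :=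
  forall a, A a ->
  exists (U : set 'rV[R]_n) p (V : set 'rV[R]_p) (alpha : 'rV[R]_(p + n) -> R)
    (v : 'rV[fermat]_p),
    [/\ open_nbhs (map_mx st a) U, open V, smooth_on (prod_set V U) alpha,
        ext_set V v
      & forall x, A x -> ext_set U x -> f x = fext alpha (row_mx v x)].

Definition quasi_standard_smooth (f : fermat -> fermat) : Prop :=
  quasi_standard_smooth_on setT (fun x : 'rV[fermat]_1 => f (x 0 0)).

Definition is_integral01 (f : fermat -> fermat) (I : fermat) : Prop :=
  exists (U : set R) m (a : m.-tuple R) (alpha0 : R -> R)
    (alpha : 'I_m -> R -> R),
    [/\ open U /\ `[0, 1] `<=` U, exponents a,
        smooth_on U alpha0 /\ (forall i, smooth_on U (alpha i)),
        forall x, U (st x) -> f x =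
          fext1 alpha0 x + \sum_(i < m) fext1 (alpha i) x * tpow (tnth a i)
      & I = quasi_decomp (\int[lebesgue_measure]_(x in `[0, 1]) alpha0 x) a
              [tuple \int[lebesgue_measure]_(x in `[0, 1]) alpha i x | i < m]].

(* For a quasi-standard smooth f exactly one I satisfies is_integral01 f I. *)
Definition integral01 (f : fermat -> fermat) : fermat :=
  xget 0 [set I | is_integral01 f I].

End FermatReals.

Record topology (T : Type) := Topology {
  opens : set (set T) ;
  opensT : opens setT ;
  opensI : setI_closed opens ;
  opens_bigU : forall (I : Type) (F : I -> set T),
    (forall i, opens (F i)) -> opens (\bigcup_i F i) }.

Definition topologized (T : Type) (tau : topology T) : Type := T.

HB.instance Definition _ (T : zmodType) (tau : topology T) :=
  GRing.Zmodule.copy (topologized tau) T.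
HB.instance Definition _ (T : zmodType) (tau : topology T) :=
  isOpenTopological.Build (topologized tau)
    (@opensT T tau) (@opensI T tau) (@opens_bigU T tau).

Definition topology_on_fermat (R : realType) (tau : topology (fermat R)) : Prop :=
  let FR := topologized tau in
  [/\ hausdorff_space FR,
      continuous (fun z : FR * FR => z.1 + z.2)
    & continuous (-%R : FR -> FR)].

Definition converges (R : realType) (tau : topology (fermat R))
    (u : nat -> fermat R) : Prop :=
  exists l : topologized tau, (u : nat -> topologized tau) @ \oo --> l.

(* Main.v *)
(* An infinitesimal multiple of t is below 1 whatever its real coefficient, so
   domination does not prevent mass from escaping: if h_n is a smooth bump
   supported in [0, 1/(n+1)] with integral 1 over [0, 1], then the functions
   f_n(x) = h_n(st x) t for odd n, and f_n = 0 for even n, satisfy |f_n| <= 1,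
   and f_n(x) vanishes for all large n at every fixed x, so (f_n) converges
   pointwise in any topology.  The integrals alternate between 0 and t, hence
   have no limit in any Hausdorff topology.

   Two facts about the Fermat reals make this computation legitimate: the
   composite of a smooth function with a little-oh polynomial is again one
   (Taylor expansion up to an order making the remainder o(t)), and the powers
   t^a, 0 < a <= 1, are linearly independent modulo o(t), so that the integral
   of f_n does not depend on the chosen decomposition. *)
Require Import Defs.
From mathcomp Require Import all_boot all_order all_algebra.
From mathcomp Require Import ring lra.
From mathcomp Require Import all_classical all_reals all_analysis.
From mathcomp Require Import measurable_realfun.
Set Implicit Arguments.
Unset Strict Implicit.
Unset Printing Implicit Defensive.
Import Order.TTheory GRing.Theory Num.Theory.
Import numFieldNormedType.Exports.
Local Open Scope classical_set_scope.
Local Open Scope ring_scope.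

(** * Germs of little-oh polynomials *)

Section Germs.
Variable R : realType.
Implicit Types (x y : R -> R) (u v : fermat R).

Lemma little_oh_polyP (X : LittleOh R) : is_little_oh_poly X.
Proof. by case: X => X /= /asboolP. Qed.

(** [germ] goes through [insubd], which falls back on 0. On little-oh polynomials the fallback never
    occurs, and a true representative lets [\pi] act as a ring morphism. *)
Lemma germ_pi x : is_little_oh_poly x ->
  exists X : LittleOh R, (X : R -> R) = x /\ germ x = \pi_(fermat R)%qT X.
Proof.
move=> xP; have xin : x \in @little_oh_poly R by apply/asboolP.
exists (MkLittleOh xin); split=> //; rewrite /germ; congr (\pi_(fermat R)%qT _).
by apply: val_inj; rewrite insubdK.
Qed.

Lemma germ_path u : germ (path_of u) = u.
Proof.
rewrite /germ /path_of -[RHS]reprK; congr (\pi_(fermat R)%qT _).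
by apply: val_inj; rewrite insubdK//; case: (repr u).
Qed.

Lemma path_little_oh u : is_little_oh_poly (path_of u).
Proof. exact: little_oh_polyP. Qed.

Lemma germ_eqP x y : is_little_oh_poly x -> is_little_oh_poly y ->
  germ x = germ y <-> x 0 = y 0 /\ (fun t => x t - y t) =o_ (0^'+) (@id R).
Proof.
move=> /germ_pi[X [<- ->]] /germ_pi[Y [<- ->]].
have : reflect (\pi_(fermat R)%qT X = \pi_(fermat R)%qT Y)
         ((X - Y) \in @Defs.negligible R).
  rewrite -Quotient.equivE; apply: (iffP idP) => [h|/eqP].
    by apply/eqP; rewrite eqmodE.
  by rewrite eqmodE.
move=> /rwP h; split.
  move=> /h /asboolP[].
  by move=> /eqP; rewrite subr_eq0 => /eqP.
move=> [h0 ho]; apply/h; apply/asboolP; split => //.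
by change (X 0 - Y 0 = 0); rewrite h0 subrr.
Qed.

Lemma germM x y : is_little_oh_poly x -> is_little_oh_poly y ->
  germ (fun t => x t * y t) = germ x * germ y.
Proof.
move=> px py; have [Z [ZE ->]] := germ_pi (is_little_oh_polyM px py).
have [X [XE ->]] := germ_pi px; have [Y [YE ->]] := germ_pi py.
rewrite -[RHS]rmorphM; congr (\pi_(fermat R)%qT _); apply: val_inj.
by rewrite /= ZE -XE -YE.
Qed.

Lemma germB x y : is_little_oh_poly x -> is_little_oh_poly y ->
  germ (fun t => x t - y t) = germ x - germ y.
Proof.
move=> px py; have [Z [ZE ->]] := germ_pi (is_little_oh_polyB px py).
have [X [XE ->]] := germ_pi px; have [Y [YE ->]] := germ_pi py.
rewrite -[RHS]rmorphB; congr (\pi_(fermat R)%qT _); apply: val_inj.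
by rewrite /= ZE -XE -YE.
Qed.

Lemma is_little_oh_polyD x y : is_little_oh_poly x -> is_little_oh_poly y ->
  is_little_oh_poly (fun t => x t + y t).
Proof.
move=> px py; have := is_little_oh_polyB px
  (is_little_oh_polyB (is_little_oh_poly_cst (0 : R)) py).
by congr is_little_oh_poly; apply/funext => t /=; rewrite sub0r opprK.
Qed.

Lemma germD x y : is_little_oh_poly x -> is_little_oh_poly y ->
  germ (fun t => x t + y t) = germ x + germ y.
Proof.
move=> px py; have [Z [ZE ->]] := germ_pi (is_little_oh_polyD px py).
have [X [XE ->]] := germ_pi px; have [Y [YE ->]] := germ_pi py.
rewrite -[RHS]rmorphD; congr (\pi_(fermat R)%qT _); apply: val_inj.
by rewrite /= ZE -XE -YE.
Qed.

End Germs.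

(** * Finite differentiability and Taylor expansions *)

Section FiniteDerivability.
Variable R : realType.
Implicit Types (f g h : R -> R) (x c : R).

(** Each derivative is exhibited as a function on the whole line, so closure properties go by
    induction. The last one is not asked to be continuous, hence the shifts by one order below. *)
Fixpoint n_derivable (n : nat) h : Prop :=
  if n is m.+1 then
    exists2 h' : R -> R, (forall x : R, is_derive x 1 h (h' x)) & n_derivable m h'
  else True.

Lemma n_derivableW n h : n_derivable n.+1 h -> n_derivable n h.
Proof.
elim: n h => [//|n ih] h [h' hh' h'n]; exists h' => //; exact: ih.
Qed.

Lemma n_derivable_cst n c : n_derivable n (cst c : R -> R).
Proof.
elim: n c => [//|n ih] c; exists (cst 0); last exact: ih.
by move=> x; exact: is_derive_cst.
Qed.

Lemma n_derivableD n f g :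
  n_derivable n f -> n_derivable n g -> n_derivable n (fun x => f x + g x).
Proof.
elim: n f g => [//|n ih] f g [f' ff' f'n] [g' gg' g'n].
exists (fun x => f' x + g' x); last exact: ih.
by move=> x; have := is_deriveD (ff' x) (gg' x).
Qed.

Lemma n_derivableM n f g :
  n_derivable n f -> n_derivable n g -> n_derivable n (fun x => f x * g x).
Proof.
elim: n f g => [//|n ih] f g fn gn.
(* The product rule keeps [f] and [g] themselves, so they are needed at the lower order too. *)
have [fn' gn'] := (n_derivableW fn, n_derivableW gn).
move: fn gn => [f' ff' f'n] [g' gg' g'n].
exists (fun x => f x * g' x + g x * f' x).
  by move=> x; have := is_deriveM (ff' x) (gg' x).
by apply: n_derivableD; apply: ih.
Qed.

Lemma n_derivable_reflect n c h :
  n_derivable n h -> n_derivable n (fun x => h (c - x)).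
Proof.
elim: n h => [//|n ih] h [h' hh' h'n].
exists (fun x => -1 * h' (c - x)).
  move=> x; rewrite mulrC.
  apply: (@is_derive1_comp _ h (fun x => c - x) x _ _ (hh' _)).
  have := is_deriveB (is_derive_cst c x 1) (is_derive_id x 1).
  by rewrite sub0r.
by apply: n_derivableM; [exact: n_derivable_cst|exact: ih].
Qed.

Lemma n_derivable_continuous n h : n_derivable n.+1 h -> continuous h.
Proof.
move=> [h' hh' _] x; apply: differentiable_continuous.
by apply/derivable1_diffP; have [] := hh' x.
Qed.

(** The difference quotient at 0 is at most C|h|. This serves at the point where [flat] is glued to
    0. *)
Lemma is_derive0_quadratic (C : R) f :
  (forall x, `|f x| <= C * x ^+ 2) -> is_derive (0 : R) 1 f 0.
Proof.
move=> fC.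
have f0 : f 0 = 0 by apply/eqP; rewrite -normr_le0 (le_trans (fC _))// expr0n mulr0.
have lim : h^-1 *: (f (h *: 1 + 0) - f 0) @[h --> (0:R)^'] --> (0 : R).
  apply/cvgr0Pnorm_le => e e0; near=> h.
  have h0 : h != 0 by near: h; exact: nbhs_dnbhs_neq.
  rewrite f0 subr0 addr0 [h *: 1]mulr1 normrM normfV ler_pdivrMl ?normr_gt0//.
  apply: (le_trans (fC _)); rewrite -real_normK ?num_real// expr2 mulrA [leRHS]mulrC.
  rewrite ler_wpM2r//.
  have hC : `|h| <= e / (`|C| + 1).
    by near: h; apply: dnbhs0_le; rewrite divr_gt0// ltr_wpDl.
  rewrite ler_pdivlMr ?ltr_wpDl// in hC.
  apply: le_trans hC; rewrite mulrC ler_wpM2l// (le_trans (ler_norm _))// lerDl//.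
apply: DeriveDef; first by apply/cvg_ex; exists 0.
exact/cvg_lim.
Unshelve. all: by end_near. Qed.

(** For [k = 0] this is the classical e^(-1/x) extended by 0. The factors x^(-k) make the family
    stable under differentiation, up to linear combinations. *)
Definition flat k (x : R) : R :=
  if 0 < x then x^-1 ^+ k * expR (- x^-1) else 0.

Lemma flat_ge0 k x : 0 <= flat k x.
Proof.
rewrite /flat; case: ifPn => // x0.
by rewrite mulr_ge0 ?expR_ge0// exprn_ge0// invr_ge0 ltW.
Qed.

Lemma flat_le0 k x : x <= 0 -> flat k x = 0.
Proof. by rewrite /flat ltNge => ->. Qed.

Lemma flat_gt0 k x : 0 < x -> 0 < flat k x.
Proof. by move=> x0; rewrite /flat x0 mulr_gt0 ?expR_gt0// exprn_gt0// invr_gt0. Qed.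

(** With y = 1/x, the exponential series gives e^y >= y^(k+2) / (k+2)!, hence y^k e^(-y) <= (k+2)! /
    y^2. *)
Lemma flat_quadratic k x : `|flat k x| <= k.+2`!%:R * x ^+ 2.
Proof.
rewrite ger0_norm ?flat_ge0// /flat; case: ifPn => x0; last first.
  by rewrite mulr_ge0 ?sqr_ge0.
have y0 : 0 < x^-1 by rewrite invr_gt0.
rewrite expRN ler_pdivrMr ?expR_gt0//.
have /(le_trans _) H := expR_ge1Dxn k.+1 (ltW y0).
have {H} : x^-1 ^+ k.+2 / k.+2`!%:R <= expR x^-1 by apply: H; rewrite lerDr.
rewrite ler_pdivrMr ?ltr0n ?fact_gt0// => H.
rewrite mulrAC -ler_pdivrMr ?exprn_gt0// -exprVn -exprD addn2 mulrC//.
Qed.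

Lemma is_derive_flat k (x : R) :
  is_derive x 1 (flat k : R -> R) (flat k.+2 x + (- k%:R) * flat k.+1 x).
Proof.
have [x0|x0|->] := ltgtP x 0.
- rewrite !flat_le0 ?(ltW x0)// mulr0 addr0.
  apply: (@near_eq_is_derive _ _ _ (cst 0)).
  + near=> z; rewrite flat_le0 ?ltW//; near: z; exact: lt_nbhsl.
- apply: (@near_eq_is_derive _ _ _ (fun x => x^-1 ^+ k * expR (- x^-1))).
    by near=> z; rewrite /flat ifT//; near: z; exact: lt_nbhsr.
  have dV : is_derive x 1 (fun z : R => z^-1) (- x ^- 2).
    apply: DeriveDef; first by apply: derivableV; rewrite ?gt_eqF.
    rewrite (@deriveV _ _ id)// ?gt_eqF// derive_id.
    by rewrite [LHS]mulr1.
  have dE : is_derive x 1 (fun z : R => expR (- z^-1)) (expR (- x^-1) * - - x ^- 2).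
    exact: (is_derive1_comp (is_derive_expR _) (is_deriveN dV)).
  have dX : is_derive x 1 (fun z : R => z^-1 ^+ k) (k%:R * x^-1 ^+ k.-1 * (- x ^- 2)).
    have -> : (fun z : R => z^-1 ^+ k) = (fun z : R => z^-1) ^+ k.
      by apply/funext => z; rewrite fctE.
    exact: (is_deriveX k dV).
  have := is_deriveM dX dE.
  move=> H; apply: is_derive_eq H _. 
  rewrite /flat x0 /GRing.scale/= -exprVn.
  by case: k {dX} => [|k]; rewrite ?exprS /=; ring.
- rewrite !flat_le0// mulr0 addr0.
  by apply: (@is_derive0_quadratic k.+2`!%:R) => z; exact: flat_quadratic.
Unshelve. all: by end_near. Qed.

Lemma n_derivable_flat n k : n_derivable n (flat k).
Proof.
elim: n k => [//|n ih] k; exists (fun x => flat k.+2 x + (- k%:R) * flat k.+1 x).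
  exact: is_derive_flat.
by apply: n_derivableD => //; apply: n_derivableM => //; exact: n_derivable_cst.
Qed.

Lemma mean_value0 (g g' : R -> R) : (forall x : R, is_derive x 1 g (g' x)) ->
  forall e, exists2 c, `|c| <= `|e| & g e - g 0 = g' c * e.
Proof.
move=> gg' e.
have gc : continuous g.
  move=> x; apply: differentiable_continuous.
  by apply/derivable1_diffP; have [] := gg' x.
have [e0|e0] := leP 0 e.
  have [|c] := @MVT_segment _ g g' 0 e e0 (fun x _ => gg' x).
    exact: continuous_subspaceT.
  rewrite in_itv/= => /andP[c0 ce] ->; exists c; last by rewrite subr0.
  by rewrite !ger0_norm.
have [|c] := @MVT_segment _ g g' e 0 (ltW e0) (fun x _ => gg' x).
  exact: continuous_subspaceT.
rewrite in_itv/= => /andP[ec c0] ge; exists c.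
  by rewrite !ler0_norm ?lerN2// ltW.
by rewrite -opprB ge sub0r mulrN opprK.
Qed.

Lemma poly_primitive (Q : {poly R}) c : exists2 P : {poly R}, P^`()%R = Q & P.[0] = c.
Proof.
exists (c%:P + \sum_(i < size Q) (Q`_i / i.+1%:R) *: 'X^(i.+1)).
  rewrite derivD derivC add0r raddf_sum/= -[RHS]coefK poly_def.
  apply: eq_bigr => i _; rewrite derivZ derivXn -scalerMnr scalerMnl -mulr_natr.
  by rewrite divfK// pnatr_eq0.
rewrite hornerD hornerC horner_sum big1 ?addr0// => i _.
by rewrite hornerZ hornerXn expr0n/= mulr0.
Qed.

(* Integrating the expansion of h' : the mean value theorem bounds the error. *)
Lemma taylor_poly n h r : n_derivable n.+1 h ->
  exists (P : {poly R}) (C : R),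
    \forall e \near (0 : R), `|h (r + e) - P.[e]| <= C * `|e| ^+ n.
Proof.
elim: n h => [|n ih] h.
  (* At order 0 only boundedness near [r] is claimed, so the zero polynomial suffices. *)
  move=> /n_derivable_continuous /(_ r) hc; exists 0, (`|h r| + 1).
  have : h (r + e) @[e --> (0 : R)] --> h r.
    apply: continuous_cvg; first exact: hc.
    by rewrite -[X in _ --> X]addr0; apply: cvgD; [exact: cvg_cst|exact: cvg_id].
  move/cvgr_dist_lt => /(_ _ ltr01); apply: filterS => e he.
  rewrite horner0 subr0 expr0 mulr1 -[h (r + e)](subKr (h r)).
  by rewrite (le_trans (ler_normB _ _))// lerD2l ltW.
move=> [h' hh' /ih[Q [C]]] /nbhs_ballP[d /= d0 hQ].
have [P PQ P0] := poly_primitive Q (h r).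
(* The sign of [C] is unknown; passing to its absolute value allows [c] to be replaced by the larger
   [e] in the bound. *)
exists P, `|C|; apply/nbhs_ballP; exists d => //= e ed.
have gd (z : R) : is_derive z 1 (fun e => h (r + e) - P.[e]) (h' (r + z) - Q.[z]).
  rewrite -PQ.
  have h1 : is_derive z 1 (fun e => r + e) 1.
    by have := is_deriveD (is_derive_cst r z 1) (is_derive_id z 1); rewrite add0r.
  have h2 := is_derive1_comp (hh' (r + z)) h1; rewrite mulr1 in h2.
  exact: (is_deriveB h2 (is_derive_poly P z)).
have [c ce] := mean_value0 gd e.
rewrite addr0 P0 subrr subr0 => ->.
rewrite normrM exprSr mulrA ler_wpM2r//.
have /hQ /le_trans : ball 0 d c.
  by move: ed; rewrite -!ball_normE /= !sub0r !normrN; exact: le_lt_trans.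
apply; rewrite (@le_trans _ _ (`|C| * `|c| ^+ n))//.
  by rewrite ler_wpM2r ?exprn_ge0// ler_norm.
by rewrite ler_wpM2l// lerXn2r ?nnegrE.
Qed.

End FiniteDerivability.

(** * Little-oh polynomials under smooth maps *)

Section Composition.
Variable R : realType.
Implicit Types (x y : R -> R) (h : R -> R).

Lemma little_oh_perturb x y : is_little_oh_poly x -> y 0 = x 0 ->
  (fun t => y t - x t) =o_ (0^'+) (@id R) -> is_little_oh_poly y.
Proof.
move=> [s s0 xs] y0 yx; exists s => //.
have -> : (fun t => y t - (y 0 + power_sum s t)) =
    (fun t => y t - x t) + (fun t => x t - (x 0 + power_sum s t)).
  by apply/funext => t; rewrite y0; rewrite [RHS]addrA subrK.
exact: add2o.
Qed.

Lemma germ_perturb x y : is_little_oh_poly x -> y 0 = x 0 ->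
  (fun t => y t - x t) =o_ (0^'+) (@id R) -> germ y = germ x.
Proof.
by move=> xP y0 yx; apply/germ_eqP => //; exact: little_oh_perturb yx.
Qed.

(** The smallest exponent dominates once t <= 1. Capping it at 1 lets the same bound absorb an o(t)
    remainder. *)
Lemma power_sum_holder (s : seq (R * R)) : all (fun p : R * R => 0 < p.2) s ->
  exists a C : R, [/\ 0 < a, a <= 1 &
    \forall t \near 0^'+, `|power_sum s t| <= C * t `^ a].
Proof.
elim: s => [_|p s ih /= /andP[p0 /ih[a [C [a0 a1 sC]]]]].
  exists 1, 0; split => //; near=> t.
  by rewrite /power_sum big_nil normr0 mul0r.
exists (Num.min p.2 a), (`|p.1| + `|C|).
split; [by rewrite lt_min p0 a0|by rewrite ge_min a1 orbT|near=> t].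
have t0 : 0 < t by near: t; exact: nbhs_right_gt.
have t1 : t <= 1 by near: t; exact: nbhs_right_le.
rewrite /power_sum big_cons (le_trans (ler_normD _ _))// mulrDl lerD//.
  rewrite normrM ler_wpM2l// ger0_norm ?powR_ge0//.
  by rewrite ger_powR ?t0// ge_min lexx.
have /le_trans : `|power_sum s t| <= C * t `^ a by near: t.
apply; rewrite (@le_trans _ _ (`|C| * t `^ a))//.
  by rewrite ler_wpM2r ?powR_ge0// ler_norm.
by rewrite ler_wpM2l// ger_powR ?t0// ge_min lexx orbT.
Unshelve. all: by end_near. Qed.

Lemma little_oh_holder x : is_little_oh_poly x -> exists a C : R,
  0 < a /\ \forall t \near 0^'+, `|x t - x 0| <= C * t `^ a.
Proof.
move=> [s /power_sum_holder[a [C [a0 a1 sC]]] /eqoP xs].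
exists a, (C + 1); split=> //; near=> t.
have t0 : 0 < t by near: t; exact: nbhs_right_gt.
have t1 : t <= 1 by near: t; exact: nbhs_right_le.
have -> : x t - x 0 = power_sum s t + (x t - (x 0 + power_sum s t)) by ring.
rewrite (le_trans (ler_normD _ _))// mulrDl lerD//; first by near: t.
rewrite (@le_trans _ _ (1 * `|t|))//; first by near: t; apply: xs.
rewrite !mul1r gtr0_norm// ger1_powR ?t0//.
Unshelve. all: by end_near. Qed.

Lemma little_oh_horner (P : {poly R}) x : is_little_oh_poly x ->
  is_little_oh_poly (fun t => P.[x t]).
Proof.
move=> xP; elim/poly_ind: P => [|P c ih].
  have -> : (fun t => (0 : {poly R}).[x t]) = cst 0.
    by apply/funext => t; rewrite horner0.
  exact: is_little_oh_poly_cst.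
have -> : (fun t => (P * 'X + c%:P).[x t]) = (fun t => P.[x t] * x t - - c).
  by apply/funext => t; rewrite hornerMXaddC opprK.
apply: is_little_oh_polyB; last exact: is_little_oh_poly_cst.
exact: is_little_oh_polyM.
Qed.

(** Up to o(t), [h \o x] is a Taylor polynomial of [h] at [x 0] evaluated at x - x(0), and
    polynomials preserve little-oh polynomials because these form a ring. *)
Lemma little_oh_comp h x : (forall n, n_derivable n h) ->
  is_little_oh_poly x -> is_little_oh_poly (h \o x).
Proof.
move=> hn xP; have [a [C [a0 xC]]] := little_oh_holder xP.
(* x t - x 0 = O(t^a), so a Taylor remainder of order N > 1 / a is o(t). *)
have [N Na] : exists N, 1 < a * N.+1%:R.
  exists (Num.truncn a^-1); rewrite -ltr_pdivrMl// mulr1.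
  exact: truncnS_gt.
have [P [D hP]] := taylor_poly (x 0) (hn N.+2).
have qP := is_little_oh_polyB xP (is_little_oh_poly_cst (x 0)).
apply: (little_oh_perturb (little_oh_horner P qP)).
  (* At e = 0 the Taylor bound vanishes, so P(0) = h(x(0)). *)
  have := nbhs_singleton hP.
  rewrite /= addr0 normr0 expr0n mulr0 normr_le0 subr_eq0 => /eqP ->.
  by rewrite subrr.
apply/eqoP => e e0.
(* After division by t the error bound keeps a positive power of t, hence tends to 0. *)
have lim : `|D| * C ^+ N.+1 * t `^ (a * N.+1%:R - 1) @[t --> 0^'+] --> 0.
  have b0 : 0 < a * N.+1%:R - 1 by rewrite subr_gt0.
  have := cvgM (cvg_cst (`|D| * C ^+ N.+1)) (powR_cvg0 b0); rewrite mulr0; apply.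
have xP0 : x t - x 0 @[t --> 0^'+] --> (0 : R).
  have := cvgB (is_little_oh_poly_cvg xP) (cvg_cst (x 0)).
  by rewrite subrr; apply.
near=> t.
have t0 : 0 < t by near: t; exact: nbhs_right_gt.
have h1 : `|h (x t) - P.[x t - x 0]| <= D * `|x t - x 0| ^+ N.+1.
  have : `|h (x 0 + (x t - x 0)) - P.[x t - x 0]| <= D * `|x t - x 0| ^+ N.+1.
    by near: t; exact: (xP0 _ hP).
  by rewrite [x 0 + _]addrC subrK.
have h0 : `|x t - x 0| <= C * t `^ a by near: t.
have h2 : `|x t - x 0| ^+ N.+1 <= C ^+ N.+1 * t `^ (a * N.+1%:R).
  rewrite powRrM powR_mulrn ?powR_ge0// -exprMn lerXn2r ?nnegrE//.
  exact: le_trans h0.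
have h3 : `|D| * C ^+ N.+1 * t `^ (a * N.+1%:R - 1) <= e.
  rewrite (le_trans (ler_norm _))// -normrN -sub0r.
  by near: t; move/cvgr_dist_le : lim; apply.
rewrite (le_trans h1)// (@le_trans _ _ (`|D| * `|x t - x 0| ^+ N.+1))//.
  by rewrite ler_wpM2r ?exprn_ge0// ler_norm.
rewrite (@le_trans _ _ (`|D| * (C ^+ N.+1 * t `^ (a * N.+1%:R))))//.
  by rewrite ler_wpM2l.
rewrite -(mulr_powRB1 (ltW t0)) ?mulr_gt0 ?ltr0n// (gtr0_norm t0).
have -> (u v w z : R) : u * (v * (w * z)) = u * v * z * w by ring.
by rewrite ler_wpM2r// ltW.
Unshelve. all: by end_near. Qed.

End Composition.

(** * Independence of the powers of t *)

Section Decompositions.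
Variable R : realType.
Implicit Types (x y : R -> R) (s : seq (R * R)) (r c : R) (u : fermat R).

Lemma path_germP x : is_little_oh_poly x ->
  path_of (germ x) 0 = x 0 /\
  (fun t => path_of (germ x) t - x t) =o_ (0^'+) (@id R).
Proof.
move=> xP; apply/germ_eqP => //; last exact: germ_path.
exact: path_little_oh.
Qed.

Lemma st_germ x : is_little_oh_poly x -> st (germ x) = x 0.
Proof. by move=> /path_germP[]. Qed.

Lemma st_fconst r : st (fconst r) = r.
Proof. exact/st_germ/is_little_oh_poly_cst. Qed.

Lemma fconst0 : fconst 0 = 0 :> fermat R.
Proof.
have c0 := is_little_oh_poly_cst (0 : R).
by have := germB c0 c0; rewrite subrr => <-; congr germ; apply/funext => t /=;
  rewrite subrr.
Qed.

Lemma fconst1 : fconst 1 = 1 :> fermat R.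
Proof.
rewrite /fconst; have [X [XE ->]] := germ_pi (is_little_oh_poly_cst (1 : R)).
rewrite -(rmorph1 (\pi_(fermat R)%qT : LittleOh R -> fermat R)).
by congr (\pi_(fermat R)%qT _); apply: val_inj; rewrite /= XE.
Qed.

Lemma fconstN r : fconst (- r) = - fconst r :> fermat R.
Proof.
transitivity (fconst 0 - fconst r : fermat R); last by rewrite fconst0 sub0r.
rewrite -germB; [|exact: is_little_oh_poly_cst..].
by congr germ; apply/funext => t /=; rewrite sub0r.
Qed.

Lemma power_sum0 s : all (fun p : R * R => 0 < p.2) s -> power_sum s 0 = 0.
Proof.
rewrite /power_sum; elim: s => [_|p s ih /= /andP[p0 /ih {}ih]].
  by rewrite big_nil.
by rewrite big_cons ih addr0 powR0 ?mulr0// gt_eqF.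
Qed.

Lemma little_oh_power_sum r s : all (fun p : R * R => 0 < p.2) s ->
  is_little_oh_poly (fun t => r + power_sum s t).
Proof.
move=> s0; exists s => //; apply/eqoP => e e0; near=> t.
by rewrite power_sum0// addr0 subrr normr0 mulr_ge0// ltW.
Unshelve. all: by end_near. Qed.

Lemma germ_power_sum r s : all (fun p : R * R => 0 < p.2) s ->
  germ (fun t => r + power_sum s t) =
  fconst r + \sum_(p <- s) fconst p.1 * tpow p.2.
Proof.
elim: s => [_|p s ih /= /andP[p0 s0]].
  rewrite big_nil addr0; congr germ; apply/funext => t /=.
  by rewrite /power_sum big_nil addr0.
rewrite big_cons addrCA -ih// -germM; last 2 first.
- exact: is_little_oh_poly_cst.
- exact: is_little_oh_poly_powR.
rewrite -germD; first last.
- exact: little_oh_power_sum.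
- apply: is_little_oh_polyM; first exact: is_little_oh_poly_cst.
  exact: is_little_oh_poly_powR.
by congr germ; apply/funext => t; rewrite /power_sum big_cons addrCA.
Qed.

(** Divide by t^e for the smallest exponent e. The quotient tends to [k e], since the other
    exponents stay positive, and also to 0, since o(t) / t^e is small when e <= 1. So [k e = 0], and
    the remaining exponents follow by induction. *)
Lemma sorted_power_sum_eq0 (E : seq R) (k : R -> R) :
  sorted <%R E -> all (fun e => 0 < e <= 1) E ->
  (fun t => \sum_(e <- E) k e * t `^ e) =o_ (0^'+) (@id R) ->
  {in E, forall e, k e = 0}.
Proof.
elim: E => [//|e E ih] /= eE /andP[/andP[e0 e1] E01] fo.
have ke : k e = 0.
  pose s := [seq (k e', e' - e) | e' <- E].
  have s0 : all (fun p : R * R => 0 < p.2) s.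
    rewrite all_map; apply/allP => e' e'E /=; rewrite subr_gt0.
    by move: eE; rewrite path_sortedE; [case/andP => /allP/(_ _ e'E)|exact: lt_trans].
  have lim1 : k e + power_sum s t @[t --> 0^'+] --> k e.
    have := cvgD (cvg_cst (k e)) (power_sum_cvg0 s0).
    by rewrite addr0; apply.
  have lim2 : k e + power_sum s t @[t --> 0^'+] --> (0 : R).
    apply/cvgr0Pnorm_le => eps eps0; near=> t.
    have t0 : 0 < t by near: t; exact: nbhs_right_gt.
    have t1 : t <= 1 by near: t; exact: nbhs_right_le.
    have te0 : 0 < t `^ e by rewrite powR_gt0.
    have ft : `|\sum_(e <- e :: E) k e * t `^ e| <= eps * `|t|.
      by near: t; move/eqoP : fo; apply.
    rewrite -(ler_pM2r te0) -[X in _ * X <= _](gtr0_norm te0) -normrM.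
    have -> : (k e + power_sum s t) * t `^ e = \sum_(e <- e :: E) k e * t `^ e.
      rewrite big_cons mulrDl; congr (_ + _).
      rewrite /power_sum big_map mulr_suml; apply: eq_bigr => e' _ /=.
      by rewrite -mulrA -powRD ?subrK// (gt_eqF t0) implybT.
    rewrite (le_trans ft)// (gtr0_norm t0) ler_wpM2l ?(ltW eps0)//.
    by rewrite ger1_powR ?t0.
  exact: (cvg_unique (@Rhausdorff R) lim1 lim2).
move=> e'; rewrite inE => /predU1P[->//|]; apply: ih => //.
  by case: (E) eE => //= ? ? /andP[].
have <- // : (fun t => \sum_(e <- e :: E) k e * t `^ e) =
  (fun t => \sum_(e <- E) k e * t `^ e).
by apply/funext => t; rewrite big_cons ke mul0r add0r.
Unshelve. all: by end_near. Qed.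

(** Terms sharing an exponent are grouped and the distinct exponents sorted, which reduces to the
    previous case. *)
Lemma power_sum_coef_eq0 s : all (fun p : R * R => 0 < p.2 <= 1) s ->
  (power_sum s : R -> R) =o_ (0^'+) (@id R) ->
  forall e, \sum_(p <- s | p.2 == e) p.1 = 0.
Proof.
move=> s01 so e; pose E := sort <=%R (undup [seq p.2 | p <- s]).
have memE e' : (e' \in E) = (e' \in [seq p.2 | p <- s]).
  by rewrite mem_sort mem_undup.
have [eE|eE] := boolP (e \in E); last first.
  rewrite big_seq_cond big1// => p /andP[ps /eqP pe].
  by move: eE; rewrite memE -pe => /mapP; case; exists p.
apply: (@sorted_power_sum_eq0 E (fun e => \sum_(p <- s | p.2 == e) p.1)) => //.
- by rewrite sort_lt_sorted undup_uniq.
- by apply/allP => e'; rewrite memE => /mapP[p ps ->]; move/allP : s01; exact.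
have <- // : power_sum s =
  (fun t => \sum_(e <- E) (\sum_(p <- s | p.2 == e) p.1) * t `^ e).
apply/funext => t.
under [RHS]eq_bigr do rewrite mulr_suml.
rewrite (exchange_big_dep predT)//= /power_sum big_seq [RHS]big_seq; apply: eq_bigr => p ps.
under eq_bigl do rewrite eq_sym.
rewrite -big_filter filter_pred1_uniq ?sort_uniq ?undup_uniq// ?big_seq1//.
by rewrite memE map_f.
Qed.

End Decompositions.

(** * Uniqueness of the integral *)

Section Integral.
Variable R : realType.
Implicit Types (x y z h : R -> R) (r c l : R) (u : fermat R).

(** Multiplication by t kills infinitesimals: t(y - l) is o(t), so only the limit of [y] matters.
    Here [z] may be any representative of t. *)
Lemma germ_mul_tpow1 z y l : z 0 = 0 ->
  (fun t => z t - t `^ 1) =o_ (0^'+) (@id R) ->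
  y t @[t --> 0^'+] --> l ->
  germ (fun t => z t * y t) = fconst l * tpow 1.
Proof.
move=> z0 zo yl; rewrite -germM; last 2 first.
- exact: is_little_oh_poly_cst.
- exact: is_little_oh_poly_powR.
apply: germ_perturb.
- apply: is_little_oh_polyM; first exact: is_little_oh_poly_cst.
  exact: is_little_oh_poly_powR.
- by rewrite z0 mul0r powR0 ?mulr0.
have -> : (fun t => z t * y t - cst l t * t `^ 1) =
    (fun t => (z t - t `^ 1) * y t) + (fun t => t `^ 1 * (y t - l)).
  apply/funext => t.
  transitivity ((z t - t `^ 1) * y t + t `^ 1 * (y t - l)) => //=.
  by ring.
apply: add2o; first exact: littleo_id_mulr zo yl.
apply/eqoP => e e0; near=> t.
have t0 : 0 < t by near: t; exact: nbhs_right_gt.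
rewrite (powRr1 (ltW t0)) normrM mulrC ler_wpM2r// distrC.
by near: t; move/cvgr_dist_le : yl; apply.
Unshelve. all: by end_near. Qed.

Lemma path_cvg u : path_of u t @[t --> 0^'+] --> st u.
Proof. exact: is_little_oh_poly_cvg (path_little_oh u). Qed.

Lemma fext1_mul_tpow1 h u : (forall n, n_derivable n h) ->
  fext1 h u * tpow 1 = fconst (h (st u)) * tpow 1.
Proof.
move=> hn; rewrite mulrC -germM; last 2 first.
- exact: is_little_oh_poly_powR.
- exact: little_oh_comp hn (path_little_oh u).
apply: germ_mul_tpow1; first by rewrite powR0.
  by apply/eqoP => e e0; near=> t; rewrite subrr normr0 mulr_ge0// ltW.
have hc := n_derivable_continuous (hn 1%N).
exact: (cvg_comp _ _ (@path_cvg u) (hc (st u))).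
Unshelve. all: by end_near. Qed.

(** Near [r] the difference quotient is within 1 of its limit d, hence bounded by |d| + 1. *)
Lemma derivable_lipschitz_near (f : R -> R) r : derivable f r 1 ->
  exists2 K : R, 0 < K & \forall z \near r, `|f z - f r| <= K * `|z - r|.
Proof.
move=> /cvg_ex[d] /cvgr_dist_lt /(_ _ ltr01) fd.
have K0 : 0 < `|d| + 1 by rewrite ltr_wpDl.
exists (`|d| + 1) => //.
have H : \forall k \near (0 : R), `|f (k + r) - f r| <= (`|d| + 1) * `|k|.
  move: fd; rewrite near_withinE; apply: filterS => k kd.
  have [->|k0] := eqVneq k 0; first by rewrite add0r subrr !normr0 mulr0.
  have {}kd := kd k0.
  have : `|k^-1 *: (f (k *: 1 + r) - f r)| <= `|d| + 1.
    set w := _ *: _ in kd *; rewrite -(subKr d w).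
    by rewrite (le_trans (ler_normB _ _))// lerD2l ltW.
  by rewrite [k *: 1]mulr1 normrM normfV ler_pdivrMl ?normr_gt0// mulrC.
case/nbhs_ballP : H => e /= e0 He; apply/nbhs_ballP; exists e => //= z zr.
have /He : ball 0 e (z - r).
  by move: zr; rewrite -!ball_normE /= sub0r opprB.
by rewrite subrK.
Qed.

(** The stored representative of [fconst r] is only r + o(t); the local Lipschitz bound keeps the
    error o(t) after applying [f]. *)
Lemma fext1_fconst (f : R -> R) r : derivable f r 1 ->
  fext1 f (fconst r) = fconst (f r).
Proof.
move=> /derivable_lipschitz_near[K K0 fK].
have [p0 /eqoP po] := path_germP (is_little_oh_poly_cst r).
apply: germ_perturb; [exact: is_little_oh_poly_cst|by rewrite /= p0|].
apply/eqoP => e e0.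
have pr : path_of (fconst r) t @[t --> 0^'+] --> r.
  by have := @path_cvg (fconst r); rewrite st_fconst.
near=> t.
have h1 : `|f (path_of (fconst r) t) - f r| <= K * `|path_of (fconst r) t - r|.
  by near: t; exact: (pr _ fK).
rewrite (le_trans h1)// -ler_pdivlMl// mulrA.
by near: t; apply: po; rewrite mulr_gt0// invr_gt0.
Unshelve. all: by end_near. Qed.

Lemma is_integral01_mul_tpow1 (h : R -> R) (f : fermat R -> fermat R) I :
  (forall u, f u = fconst (h (st u)) * tpow 1) -> is_integral01 f I ->
  I = fconst (\int[lebesgue_measure]_(x in `[0, 1]) h x) * tpow 1.
Proof.
move=> fE [U [m [a [al0 [al [[Uo U01] aE [al0s als] fdec ->]]]]]].
have a_inj : injective (tnth a).
  move/andP : aE => [/lt_sorted_uniq /tuple_uniqP] //.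
have a01 i : 0 < tnth a i <= 1.
  by move/andP : aE => [_ /allP]; apply; exact: mem_tnth.
(* Evaluating the decomposition at the real points of [0, 1] forces al0 = 0,
   al i = h where the exponent is 1, and al i = 0 elsewhere. *)
have key r : r \in `[0, 1]%R -> al0 r = 0 /\
    (forall e, (if 1 == e then - h r else 0) +
       \sum_(i < m | tnth a i == e) al i r = 0).
  move=> r01.
  have Ur : U r by apply: U01.
  have := fdec (fconst r); rewrite st_fconst fE st_fconst => /(_ Ur).
  rewrite fext1_fconst; last by apply/derivable1_diffP; case: (al0s 1%N) => d _; exact: d.
  under eq_bigr => i _.
    rewrite fext1_fconst; last by apply/derivable1_diffP; case: (als i 1%N) => d _; exact: d.
    over.
  move=> /esym/eqP; rewrite -subr_eq0 => /eqP dec.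
  (* The term -h(r) at exponent 1 brings the value of [f] to the other side, so the whole sum is
     negligible and independence applies. *)
  pose s := (- h r, 1) :: [seq (al i r, tnth a i) | i <- enum 'I_m].
  have s01 : all (fun p : R * R => 0 < p.2 <= 1) s.
    by rewrite /= ltr01 lexx/= all_map; apply/allP => i _ /=.
  have s0 : all (fun p : R * R => 0 < p.2) s.
    by apply/allP => p ps; move/allP : s01 => /(_ p ps) /andP[].
  have : germ (fun t => al0 r + power_sum s t) = fconst 0.
    rewrite germ_power_sum// big_cons big_map big_enum/= fconstN mulNr fconst0.
    by rewrite addrCA addrC -[RHS]dec.
  case/germ_eqP; [exact: little_oh_power_sum|exact: is_little_oh_poly_cst|].
  rewrite power_sum0// addr0 => al00 so; split => // e.
  have := @power_sum_coef_eq0 R s s01 _ e.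
  rewrite big_cons big_map big_enum_cond/=.
  have -> : (if 1 == e then - h r + \sum_(i < m | tnth a i == e) al i r else
      \sum_(i < m | tnth a i == e) al i r) =
     (if 1 == e then - h r else 0) + \sum_(i < m | tnth a i == e) al i r.
    by case: ifP => //; rewrite add0r.
  apply.
  have <- // : (fun t => al0 r + power_sum s t - cst 0 t) = power_sum s.
  by apply/funext => t; rewrite al00 add0r subr0.
have int0 (k : R -> R) : (forall r, r \in `[0, 1]%R -> k r = 0) ->
    \int[lebesgue_measure]_(x in `[0, 1]) k x = 0.
  move=> k0; rewrite (@eq_Rintegral _ _ _ _ _ (cst 0)).
    by rewrite Rintegral_cst// mul0r.
  by move=> r; rewrite inE => r01; apply: k0.
have al_ne i r : tnth a i != 1 -> r \in `[0, 1]%R -> al i r = 0.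
  move=> ai /key[_ /(_ (tnth a i))].
  rewrite eq_sym (negbTE ai) add0r (big_pred1 i)// => j.
  by rewrite (inj_eq a_inj).
have al_eq i r : tnth a i = 1 -> r \in `[0, 1]%R -> al i r = h r.
  move=> ai /key[_ /(_ (tnth a i))].
  rewrite ai eqxx (big_pred1 i).
    by move=> /eqP; rewrite addrC subr_eq0 => /eqP.
  by move=> j; rewrite /= -ai (inj_eq a_inj).
rewrite /quasi_decomp int0; last by move=> r /key[].
rewrite fconst0 add0r.
(* If exponent 1 occurs, it occurs once, and its term alone survives. *)
have [i ai|no] := pickP (fun i => tnth a i == 1).
  rewrite (bigD1 i)//= big1 ?addr0.
    rewrite tnth_mktuple (eqP ai); congr (fconst _ * _).
    by apply: eq_Rintegral => r; rewrite inE => r01; apply: al_eq => //; exact/eqP.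
  move=> j ji; rewrite tnth_mktuple int0 ?fconst0 ?mul0r// => r.
  by apply: al_ne; rewrite -(eqP ai) (inj_eq a_inj).
rewrite big1; last first.
  move=> j _; rewrite tnth_mktuple int0 ?fconst0 ?mul0r// => r.
  by apply: al_ne; rewrite no.
(* Without exponent 1 the coefficient equation at 1 reads -h(r) = 0, so the integral of [h] is 0 as
   well. *)
rewrite int0 ?fconst0 ?mul0r// => r /key[_ /(_ 1)].
rewrite eqxx big_pred0// addr0 => /eqP.
by rewrite oppr_eq0 => /eqP.
Qed.

End Integral.

(** * Smooth bumps *)

Section Smoothness.
Variables (R : realType) (E : normedModType R).
Implicit Types f g : E -> R.

Lemma Ck_setTW k f : Ck k.+1 setT f -> Ck k setT f.
Proof.
elim: k f => [f [df _] p _|k ih f [df Df]].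
  exact/differentiable_continuous/df.
by split=> // v; exact: ih.
Qed.

Lemma Ck_setTD k f g :
  Ck k setT f -> Ck k setT g -> Ck k setT (fun p => f p + g p).
Proof.
elim: k f g => [f g fc gc p pT|k ih f g [df Df] [dg Dg]].
  exact: continuousD (fc p pT) (gc p pT).
split=> [p pT|v]; first exact: differentiableD (df p pT) (dg p pT).
have -> : 'D_v (fun p => f p + g p) = (fun p => 'D_v f p + 'D_v g p).
  apply/funext => p.
  by apply: (@deriveD _ _ _ f g); apply: diff_derivable; [exact: df|exact: dg].
exact: ih (Df v) (Dg v).
Qed.

Lemma Ck_setTM k f g :
  Ck k setT f -> Ck k setT g -> Ck k setT (fun p => f p * g p).
Proof.
elim: k f g => [f g fc gc p pT|k ih f g fC gC].
  exact: continuousM (fc p pT) (gc p pT).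
have [fC' gC'] := (Ck_setTW fC, Ck_setTW gC).
move: fC gC => [df Df] [dg Dg].
split=> [p pT|v]; first exact: differentiableM (df p pT) (dg p pT).
have -> : 'D_v (fun p => f p * g p) = (fun p => f p * 'D_v g p + g p * 'D_v f p).
  apply/funext => p.
  by apply: (@deriveM _ _ f g); apply: diff_derivable; [exact: df|exact: dg].
exact: Ck_setTD (ih _ _ fC' (Dg v)) (ih _ _ gC' (Df v)).
Qed.

Lemma Ck_setT_cst k (c : R) : Ck k setT (fun _ : E => c).
Proof.
elim: k c => [c p _|k ih c]; first exact: cst_continuous.
split=> [p _|v]; first exact: differentiable_cst.
have -> : 'D_v (fun _ : E => c) = (fun=> 0) by apply/funext => p; exact: derive_cst.
exact: ih.
Qed.

(** The derivative along [v] is the constant [l v] times [h' \o l], again of this form. The order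
    [k.+1] pays for the continuity that [Ck] asks of the last derivative. *)
Lemma Ck_setT_comp_linear k (l : {linear E -> R}) (h : R -> R) : continuous l ->
  n_derivable k.+1 h -> Ck k setT (h \o l).
Proof.
move=> lc; elim: k h => [h hn p _|k ih h [h' hh' h'n]].
  apply: continuous_comp; first exact: lc.
  exact: (n_derivable_continuous hn).
have dl p : differentiable l p by apply: linear_differentiable; exact: lc.
have dh r : differentiable h r by apply/derivable1_diffP; have [] := hh' r.
split=> [p _|v]; first exact: differentiable_comp.
have -> : 'D_v (h \o l) = (fun p => l v * h' (l p)).
  apply/funext => p; rewrite deriveE; last exact: differentiable_comp.
  rewrite diff_comp//= diff_lin//.
  rewrite deriv1E; last by have [] := hh' (l p).
  by rewrite derive1E (@derive_val _ _ _ _ _ _ _ (hh' (l p))).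
apply: Ck_setTM; last exact: ih.
exact: Ck_setT_cst.
Qed.

End Smoothness.

(** * Bump functions on the line and their integrals *)

Section Bumps.
Variable R : realType.

Lemma smooth_on_n_derivable (h : R -> R) : (forall n, n_derivable n h) ->
  smooth_on setT h.
Proof.
move=> hn k; have := @Ck_setT_comp_linear R R k idfun h.
by apply => // x; exact: cvg_id.
Qed.

(** For w = (v, x) this is alpha(v, x) = v h(x), which displays h(st x) t as quasi-standard smooth
    when v is t. *)
Lemma smooth_on_coord_mul n (i j : 'I_n) (h : R -> R) :
  (forall m, n_derivable m h) ->
  smooth_on setT (fun w : 'rV[R]_n => w 0 i * h (w 0 j)).
Proof.
move=> hn k.
have coord (e : 'I_n) (g : R -> R) : n_derivable k.+1 g ->
    Ck k setT (fun w : 'rV[R]_n => g (w 0 e)).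
  move=> gn.
  have @f : {linear 'rV[R]_n -> R}.
    by exists (fun N : 'rV[R]_n => N 0 e); do 2![eexists]; do ?[constructor];
      rewrite ?mxE// => ? *; rewrite ?mxE//; move=> ?; rewrite !mxE.
  by apply: (@Ck_setT_comp_linear R _ k f g) => //; exact: coord_continuous.
apply: Ck_setTM; last exact: coord.
apply: (coord i id); elim: k {coord} => [|k ih].
  by exists (cst 1) => // x; exact: is_derive_id.
exists (cst 1); last exact: n_derivable_cst.
by move=> x; exact: is_derive_id.
Qed.

(** On [a, b] the minimum of [h] is attained, hence positive; times b - a it bounds the integral
    from below. *)
Lemma integral01_gt0 (h : R -> R) (a b : R) : continuous h -> (forall x, 0 <= h x) ->
  0 <= a -> a < b -> b <= 1 -> (forall x, a <= x <= b -> 0 < h x) ->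
  0 < \int[lebesgue_measure]_(x in `[0, 1]) h x.
Proof.
move=> hc h0 a0 ab b1 hpos.
have hm (D : set R) : measurable_fun D h.
  by apply: measurable_funTS; exact: continuous_measurable_fun.
have [|c] := @EVT_min _ h a b (ltW ab); first exact: continuous_subspaceT.
rewrite in_itv/= => cab cmin.
have hfin : (\int[lebesgue_measure]_(x in `[0%R, 1%R]) (h x)%:E)%E \is a fin_num.
  apply: integrable_fin_num => //=.
  apply: continuous_compact_integrable; first exact: segment_compact.
  exact: continuous_subspaceT.
rewrite -lte_fin /Rintegral fineK//.
apply: (@lt_le_trans _ _ (\int[lebesgue_measure]_(x in `[a, b]) (cst (h c)%:E x))%E).
  rewrite integral_cst//= lebesgue_measure_itv/= lte_fin ab -EFinB -EFinM lte_fin.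
  by rewrite mulr_gt0 ?subr_gt0// hpos.
apply: (@le_trans _ _ (\int[lebesgue_measure]_(x in `[a, b]) (h x)%:E)%E).
  apply: ge0_le_integral => //=.
    by move=> x _; rewrite lee_fin.
  by apply/measurable_EFinP; exact: hm.
apply: ge0_subset_integral => //=.
- by apply/measurable_EFinP; exact: hm.
- by move=> x _; rewrite lee_fin.
- move=> x /=; rewrite !in_itv/= => /andP[ax xb].
  by rewrite (le_trans a0 ax) (le_trans xb b1).
Qed.

(** On the open interval from 0 to [d] this is e^(-1/x) e^(-1/(d-x)); elsewhere it vanishes. *)
Definition flat_bump (d x : R) : R := flat 0 x * flat 0 (d - x).

Lemma n_derivable_flat_bump n d : n_derivable n (flat_bump d).
Proof.
apply: n_derivableM; first exact: n_derivable_flat.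
exact/n_derivable_reflect/n_derivable_flat.
Qed.

Lemma flat_bump_gt0 d x : 0 < x -> x < d -> 0 < flat_bump d x.
Proof. by move=> x0 xd; rewrite mulr_gt0 ?flat_gt0 ?subr_gt0. Qed.

Lemma flat_bump_out d x : x <= 0 \/ d <= x -> flat_bump d x = 0.
Proof.
by rewrite /flat_bump => -[?|?]; [rewrite flat_le0 ?mul0r|rewrite mulrC flat_le0 ?mul0r ?subr_le0].
Qed.

Lemma integral_flat_bump_gt0 d : 0 < d -> d <= 1 ->
  0 < \int[lebesgue_measure]_(x in `[0, 1]) flat_bump d x.
Proof.
(* Any nondegenerate closed interval strictly between 0 and [d] would do. *)
move=> d0 d1; apply: (@integral01_gt0 _ (d / 3) (d / 2)).
- exact: (n_derivable_continuous (n_derivable_flat_bump 1 d)).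
- by move=> x; rewrite mulr_ge0 ?flat_ge0.
- lra.
- lra.
- lra.
- by move=> x /andP[ax xb]; apply: flat_bump_gt0; lra.
Qed.

End Bumps.

(** * The counterexample *)

Section Counterexample.
Variable R : realType.
Implicit Types (u : fermat R) (h : R -> R) (c : R).

(** For smooth [h] this equals the Fermat extension of [h] times t: the factor t erases the
    infinitesimal part of [u]. *)
Definition ext_tpow1 h u : fermat R := fconst (h (st u)) * tpow 1.

Lemma little_oh_cst_tpow1 c :
  is_little_oh_poly (fun t : R => cst c t * t `^ 1).
Proof.
apply: is_little_oh_polyM; first exact: is_little_oh_poly_cst.
exact: is_little_oh_poly_powR.
Qed.

Lemma st_mul_tpow1 c : st (fconst c * tpow 1) = 0.
Proof.
rewrite -germM; last 2 first.
- exact: is_little_oh_poly_cst.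
- exact: is_little_oh_poly_powR.
by rewrite st_germ ?powR0 ?mulr0//; exact: little_oh_cst_tpow1.
Qed.

Lemma tpow1_neq0 : tpow 1 <> 0 :> fermat R.
Proof.
rewrite -fconst0 => /germ_eqP[| |_ /eqoP tt].
- exact: is_little_oh_poly_powR.
- exact: is_little_oh_poly_cst.
have : \forall t \near (0 : R)^'+, False.
  near=> t.
  have t0 : 0 < t by near: t; exact: nbhs_right_gt.
  have : `|t `^ 1 - cst 0 t| <= 2^-1 * `|t|.
    by near: t; apply: tt; rewrite invr_gt0.
  by rewrite subr0 (powRr1 (ltW t0)) gtr0_norm//; lra.
by move=> /filter_ex[].
Unshelve. all: by end_near. Qed.

Lemma quasi_standard_smooth_cst1 : quasi_standard_smooth (fun _ : fermat R => 1).
Proof.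
(* A constant real function takes no Fermat parameter: V is the one-point space R^0. *)
move=> a _; exists setT, 0%N, setT, (fun=> 1), 0; split => //.
- by split=> //; exact: openT.
- exact: openT.
- have -> : prod_set setT setT = setT :> set 'rV[R]_(0 + 1).
    by apply/seteqP; split.
  by move=> k; exact: Ck_setT_cst.
- by move=> x _ _; rewrite -fconst1.
Qed.

Lemma quasi_standard_smooth_ext_tpow1 h : (forall n, n_derivable n h) ->
  quasi_standard_smooth (ext_tpow1 h).
Proof.
move=> hn a _.
exists setT, 1%N, setT,
  (fun w => w 0 (lshift 1 0) * h (w 0 (rshift 1 0))), (const_mx (tpow 1)).
split => //.
- by split=> //; exact: openT.
- exact: openT.
- have -> : prod_set setT setT = setT :> set 'rV[R]_(1 + 1).
    by apply/seteqP; split.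
  exact: smooth_on_coord_mul.
- move=> x _ _; rewrite /ext_tpow1 /fext.
  (* [fext] uses the chosen representative of [tpow 1], which is t only up to o(t). *)
  have [p0 po] := path_germP (@is_little_oh_poly_powR R 1 ltr01).
  have hx : h (path_of (x 0 0) t) @[t --> 0^'+] --> h (st (x 0 0)).
    have hc := n_derivable_continuous (hn 1%N).
    exact: (cvg_comp _ _ (@path_cvg R (x 0 0)) (hc (st (x 0 0)))).
  rewrite -(germ_mul_tpow1 _ po hx); last by rewrite p0 powR0.
  congr germ; apply/funext => t; congr (_ * h _); rewrite mxE.
    by rewrite row_mxEl mxE.
  by rewrite row_mxEr.
Qed.

Lemma exponents1 : exponents [tuple (1 : R)].
Proof. by rewrite /exponents/= ltr01 lexx. Qed.

Lemma integral01_ext_tpow1 h : (forall n, n_derivable n h) ->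
  integral01 (ext_tpow1 h) =
  fconst (\int[lebesgue_measure]_(x in `[0, 1]) h x) * tpow 1.
Proof.
move=> hn; rewrite /integral01; case: xgetP => [I _ /is_integral01_mul_tpow1|none].
  exact.
(* Existence excludes the default 0 of [xget]: take alpha_0 = 0 and the single coefficient [h] at
   exponent 1. *)
exfalso; pose a := [tuple (1 : R)].
apply: (none (quasi_decomp (\int[lebesgue_measure]_(x in `[0, 1]) cst 0 x) a
  [tuple \int[lebesgue_measure]_(x in `[0, 1]) h x | i < 1])).
exists setT, 1%N, a, (cst 0), (fun=> h); split => //.
- by split; [exact: openT|].
- exact: exponents1.
- split=> [|_]; apply: smooth_on_n_derivable => // n; exact: n_derivable_cst.
- move=> u _; rewrite big_ord1 /a /= fext1_mul_tpow1//.
  have -> : fext1 (cst 0) u = 0 by rewrite -fconst0.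
  by rewrite add0r.
Qed.

(** The standard parts 0 < 1 settle the lexicographic order before [c] is compared. *)
Lemma mul_tpow1_le1 c : fermat_le (fconst c * tpow 1) 1.
Proof.
exists 1%N, [tuple 1], [tuple c], [tuple 0]; split.
- exact: exponents1.
- by rewrite st_mul_tpow1 /quasi_decomp big_ord1 fconst0 add0r.
- by rewrite -fconst1 st_fconst /quasi_decomp big_ord1 /= fconst0 mul0r addr0.
- rewrite st_mul_tpow1 -fconst1 st_fconst.
  by rewrite lexi_cons ler01 ler10.
Qed.

Lemma abs_ext_tpow1_le1 h u : fermat_le (fermat_abs (ext_tpow1 h u)) 1.
Proof.
rewrite /fermat_abs /fermat_max; case: ifP => _; last exact: mul_tpow1_le1.
by rewrite /ext_tpow1 -mulNr -fconstN; exact: mul_tpow1_le1.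
Qed.

(** Division by the integral normalises the odd bumps. The width 1/(n+1) is defined for n = 0 and
    keeps the support in [0, 1]. *)
Definition alternating_bump n (x : R) : R :=
  (if odd n then (\int[lebesgue_measure]_(x in `[0, 1]) flat_bump (n.+1%:R^-1 : R) x)^-1
   else 0) * flat_bump n.+1%:R^-1 x.

Lemma n_derivable_alternating_bump n k : n_derivable k (alternating_bump n).
Proof.
by apply: n_derivableM; [exact: n_derivable_cst|exact: n_derivable_flat_bump].
Qed.

Lemma integral_alternating_bump n :
  \int[lebesgue_measure]_(x in `[0, 1]) alternating_bump n x = (odd n)%:R.
Proof.
rewrite /alternating_bump RintegralZl//=; last first.
  apply: continuous_compact_integrable; first exact: segment_compact.
  apply: continuous_subspaceT.
  exact: (n_derivable_continuous (n_derivable_flat_bump 1 _)).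
case: ifP => _; last by rewrite mul0r.
rewrite mulVf// gt_eqF// integral_flat_bump_gt0 ?invr_gt0 ?ltr0n// invf_le1 ?ltr0n//.
by rewrite ler1n.
Qed.

(** Either x <= 0, left of every bump, or 1/(n+1) < x from some n on. *)
Lemma alternating_bump_eventually0 (x : R) :
  \forall n \near \oo, alternating_bump n x = 0.
Proof.
rewrite /alternating_bump; have [x0|x0] := leP x 0.
  by near=> n; rewrite flat_bump_out ?mulr0//; left.
apply: filterS (near_infty_natSinv_lt (PosNum x0)) => n /ltW nx.
by rewrite flat_bump_out ?mulr0//; right.
Unshelve. all: by end_near. Qed.

End Counterexample.

Theorem theorem32 (R : realType) :
  ~ exists tau : topology (fermat R),
      topology_on_fermat tau /\
      forall f : nat -> fermat R -> fermat R,
        (forall n, quasi_standard_smooth (f n)) ->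
        (forall x, converges tau (fun n => f n x)) ->
        (exists g : fermat R -> fermat R,
           quasi_standard_smooth g /\
           forall n x, fermat_le (fermat_abs (f n x)) (g x)) ->
        converges tau (fun n => integral01 (f n)).
Proof.
move=> [tau [[hausd _ _] /(_ (fun n => ext_tpow1 (alternating_bump n)))]].
have hn n k := @n_derivable_alternating_bump R n k.
case.
- by move=> n; apply: quasi_standard_smooth_ext_tpow1.
(* An eventually constant sequence converges in every topology. *)
- move=> x; exists 0; apply: cvg_near_cst.
  move: (alternating_bump_eventually0 (st x)); apply: filterS => n n0.
  by rewrite /ext_tpow1 n0 fconst0 mul0r.
- exists (fun=> 1); split; first exact: quasi_standard_smooth_cst1.
  by move=> n x; exact: abs_ext_tpow1_le1.
move=> l ul.
have intE n : integral01 (ext_tpow1 (alternating_bump n)) = fconst (odd n)%:R * tpow 1 :> fermat R.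
  by rewrite integral01_ext_tpow1// integral_alternating_bump.
(* Along the indices 2n + b the integrals are constantly b t, so uniqueness of limits gives l = b t
   for both values of b, which forces t = 0. *)
have sub (b : bool) : l = fconst b%:R * tpow 1.
  pose k n := (n.*2 + b)%N.
  have kl : (fun n => integral01 (ext_tpow1 (alternating_bump (k n)))
      : topologized tau) @ \oo --> l.
    apply: cvg_comp ul => A [N _ NA]; exists N => // n /= Nn; apply: NA => /=.
    by rewrite (leq_trans Nn)// /k -addnn -addnA leq_addr.
  apply: (cvg_unique hausd kl); apply: cvg_near_cst; apply: nearW => n.
  by rewrite intE /k oddD odd_double oddb.
apply: (@tpow1_neq0 R); have := sub true; rewrite (sub false).
by rewrite fconst0 fconst1 mul0r mul1r.
Qed.
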